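(* Let $\mathfrak{g}$ be a nilpotent Lie algebra endowed with a complex structure $J$, and let $t$ be a nonnegative integer. Then the following statements are equivalent: (i) $\mathfrak{a}_t=\mathfrak{g}$ and $\mathfrak{a}_{t-1}\subsetneq\mathfrak{g}$; (ii) $W^t=\mathfrak{g}^{1,0}$ and $W^{t-1}\subsetneq\mathfrak{g}^{1,0}$; (iii) $\mathfrak{h}^t=0$ and $\mathfrak{h}^{t-1}\neq 0$.
   Context: Lie algebras are real, of finite positive dimension. A complex structure on $\mathfrak{g}$ is a linear endomorphism $J:\mathfrak{g}\to\mathfrak{g}$ with $J^2=-1$ and $[JX,JY]=J[JX,Y]+J[X,JY]+[X,Y]$ for all $X,Y\in\mathfrak{g}$. $\mathfrak{g}^{1,0}$ is the $\sqrt{-1}$-eigenspace of $J$ acting on $\mathfrak{g}^*_{\mathbb{C}}=\mathfrak{g}^*\otimes_{\mathbb{R}}\mathbb{C}$ by $(J\alpha)(X)=\alpha(JX)$. $d$ is the Chevalley–Eilenberg differential, $d\alpha(X,Y)=-\alpha([X,Y])$, extended complex-linearly. Series (indexed by integers $k\ge 0$): - $\mathfrak{a}_0=0$ and $\mathfrak{a}_k=\{X\in\mathfrak{g} : [X,\mathfrak{g}]\subseteq\mathfrak{a}_{k-1},\ [JX,\mathfrak{g}]\subseteq\mathfrak{a}_{k-1}\}$ for $k\ge1$. - $W^0=0$ and $W^k=\{\omega\in\mathfrak{g}^{1,0} : d\omega\in (W^{k-1}\wedge W^{k-1})\oplus(W^{k-1}\wedge\overline{W}^{k-1})\}$ for $k\ge1$.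 - $\mathfrak{h}^0=\mathfrak{g}$ and $\mathfrak{h}^k=[\mathfrak{h}^{k-1},\mathfrak{g}]+J[\mathfrak{h}^{k-1},\mathfrak{g}]$ for $k\ge1$. For $t=0$ the first half of each of (i), (ii), (iii) is false because $\mathfrak{g}\neq0$, so each of the three statements is regarded as false. *)

(* Defs.v *)
From HB Require Import structures.
From mathcomp Require Import all_boot all_order all_algebra.
From mathcomp Require Import boolp classical_sets functions reals.
From mathcomp Require Import complex.
Set Implicit Arguments.
Unset Strict Implicit.
Unset Printing Implicit Defensive.
Import Order.TTheory GRing.Theory Num.Theory.
Local Open Scope classical_set_scope.
Local Open Scope ring_scope.

HB.mixin Record Vector_isLieAlgebra (K : fieldType) V of Vector K V := {
  lie : V -> V -> V;
  lie_linearl : forall Y : V, linear (lie^~ Y);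
  lie_linearr : forall X : V, linear (lie X);
  liexx : forall X : V, lie X X = 0;
  lie_jacobi : forall X Y Z : V,
    lie X (lie Y Z) + lie Y (lie Z X) + lie Z (lie X Y) = 0
}.

#[short(type="lieAlgType")]
HB.structure Definition LieAlgebra (K : fieldType) :=
  { V of Vector_isLieAlgebra K V & Vector K V }.

Definition linear_span (K : nzRingType) (V : lmodType K) (A : set V) : set V :=
  [set v | exists (n : nat) (c : 'I_n -> K) (u : 'I_n -> V),
     (forall i, A (u i)) /\ v = \sum_(i < n) c i *: u i].

Definition set_sum (V : zmodType) (A B : set V) : set V :=
  [set x + y | x in A & y in B].

Section LieAlgebraSeries.
Variables (K : fieldType) (g : lieAlgType K).

Definition lie_span (A B : set g) : set g :=
  linear_span [set lie x y | x in A & y in B].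

Fixpoint lower_central (k : nat) : set g :=
  if k is k'.+1 then lie_span (lower_central k') setT else setT.

Definition nilpotent_lie : Prop := exists k, lower_central k = [set 0].

Definition complex_structure (J : 'End(g)) : Prop :=
  (forall X : g, J (J X) = - X) /\
  (forall X Y : g, lie (J X) (J Y) =
     J (lie (J X) Y) + J (lie X (J Y)) + lie X Y).

Fixpoint a_series (J : 'End(g)) (k : nat) : set g :=
  if k is k'.+1 then
    [set X | (forall Y, a_series J k' (lie X Y)) /\
             (forall Y, a_series J k' (lie (J X) Y))]
  else [set 0].

Fixpoint h_series (J : 'End(g)) (k : nat) : set g :=
  if k is k'.+1 then
    set_sum (lie_span (h_series J k') setT)
            (J @` lie_span (h_series J k') setT)
  else setT.

End LieAlgebraSeries.

(* The complexified dual of g is realised as the space of R-linear maps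
   g -> R[i], inside the R[i]-module of all functions g -> R[i]; complex
   2-forms live in the R[i]-module of functions g -> g -> R[i]. *)
Section ComplexForms.
Variables (R : realType) (g : lieAlgType R).

Definition complex_dual : set (g -> R[i]) :=
  [set w | forall (c : R) (X Y : g), w (c *: X + Y) = (c%:C)%C * w X + w Y].

Definition forms10 (J : 'End(g)) : set (g -> R[i]) :=
  [set w | complex_dual w /\ forall X, w (J X) = 'i%C * w X].

Definition conj_form (w : g -> R[i]) : g -> R[i] := fun X => conjc (w X).

Definition dform (w : g -> R[i]) : g -> g -> R[i] :=
  fun X Y => - w (lie X Y).

Definition wedge (v w : g -> R[i]) : g -> g -> R[i] :=
  fun X Y => v X * w Y - v Y * w X.

Definition wedge_span (A B : set (g -> R[i])) : set (g -> g -> R[i]) :=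
  linear_span [set wedge v w | v in A & w in B].

(* The sum of the two wedge spaces is automatically direct, since they consist
   of forms of type (2,0) and (1,1) respectively. *)
Fixpoint W_series (J : 'End(g)) (k : nat) : set (g -> R[i]) :=
  if k is k'.+1 then
    [set w | forms10 J w /\
       set_sum (wedge_span (W_series J k') (W_series J k'))
               (wedge_span (W_series J k') (conj_form @` W_series J k'))
               (dform w)]
  else [set 0].

End ComplexForms.

Arguments nilpotent_lie {K} g.
Arguments complex_dual {R} g.

(* Main.v *)
Require Import Defs.
From mathcomp Require Import all_boot all_order all_algebra.
From mathcomp Require Import boolp classical_sets functions reals complex.
From mathcomp Require Import ring.

(** Both equivalences hold level by level: for every [k], each of
    [a_series J k = setT] and [W_series J k = forms10 J] is equivalent to
    [h_series J k = [set 0]], and the theorem follows by using this at [t] and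
    at [t.-1].

    The series [a] and [h] are related as the upper and the lower central
    series of a nilpotent Lie algebra are: [[a_(k+1), g]] lies in [a_k], and
    [h^(k+1)] is the least [J]-stable subspace containing [[h^k, g]].  So if
    [a_k] is everything, induction on [i] gives that [h^i] lies in [a_(k-i)];
    if [h^k] vanishes, induction on [i] gives that [h^(k-i)] lies in [a_i]
    ([a_series_full_iff]).

    The series [W] is dual to [h]: [W^k] consists of the (1,0)-forms that
    vanish on [h^k] ([W_seriesE]).  Indeed a (1,0)-form [w] vanishes on
    [h^(k+1)] iff [dw] is killed by contraction with [h^k].  If [dw] is a sum
    of wedge products of forms in [W^k] and their conjugates, this is clear.
    Conversely, a 2-form killed by contraction with [h^k] is a combination of
    wedge products of forms vanishing on [h^k]; splitting these into types and
    using that integrability of [J] excludes a (0,2)-part of [dw], only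
    products in [W^k /\ W^k] and [W^k /\ conj W^k] remain
    ([dform_wedge_decomposition]).  Since (1,0)-forms separate the points of
    [g] ([forms10_separate]), all of them vanish on [h^k] iff [h^k] is zero. *)

Set Implicit Arguments.
Unset Strict Implicit.
Unset Printing Implicit Defensive.
Import GRing.Theory.
Local Open Scope classical_set_scope.
Local Open Scope ring_scope.

(** * Subspaces and linear spans *)

Definition is_subspace (K : nzRingType) (V : lmodType K) (A : set V) : Prop :=
  A 0 /\ forall (c : K) x y, A x -> A y -> A (c *: x + y).

Section Subspaces.
Variables (K : nzRingType) (V : lmodType K).
Implicit Types A B : set V.

Lemma subspaceD A x y : is_subspace A -> A x -> A y -> A (x + y).
Proof. by case=> _ AL Ax Ay; rewrite -[x]scale1r; apply: AL. Qed.

Lemma subspaceZ A c x : is_subspace A -> A x -> A (c *: x).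
Proof. by case=> A0 AL Ax; rewrite -[_ *: _]addr0; apply: AL. Qed.

Lemma subspaceN A x : is_subspace A -> A x -> A (- x).
Proof. by move=> sA Ax; rewrite -scaleN1r; apply: subspaceZ. Qed.

Lemma linear_span_subset A B :
  is_subspace B -> A `<=` B -> linear_span A `<=` B.
Proof.
move=> sB AB _ [n [c [u [Au ->]]]]; elim/big_ind: _ => [|x y|i _].
- by case: sB.
- exact: subspaceD.
- by apply: subspaceZ => //; apply: AB.
Qed.

(** Frees linear combinations from the indexing by an ordinal, so that sums
    over sum types and over pairs of indices can be used. *)
Lemma linear_span_finsum A (I : finType) (c : I -> K) (u : I -> V) :
  (forall i, A (u i)) -> linear_span A (\sum_i c i *: u i).
Proof.
move=> Au; exists #|I|, (fun j => c (enum_val j)), (fun j => u (enum_val j)).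
by split=> // ; rewrite (big_enum_val (A := I)).
Qed.

Lemma linear_span_incl A : A `<=` linear_span A.
Proof.
move=> x Ax; have := @linear_span_finsum A 'I_1 (fun=> 1) (fun=> x) (fun=> Ax).
by rewrite big_ord1 scale1r.
Qed.

Lemma linear_span_subspace A : is_subspace (linear_span A).
Proof.
split; first by exists 0, (fun=> 0), (fun=> 0); split; [case | rewrite big_ord0].
move=> c _ _ [m [a [u [Au ->]]]] [n [b [v [Av ->]]]].
have := @linear_span_finsum A ('I_m + 'I_n)%type
  (fun s => match s with inl i => c * a i | inr j => b j end)
  (fun s => match s with inl i => u i | inr j => v j end).
rewrite big_sumType /= scaler_sumr.
under eq_bigr do rewrite -scalerA.
by apply; case.
Qed.

Lemma set_sum_subspace A B :
  is_subspace A -> is_subspace B -> is_subspace (set_sum A B).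
Proof.
move=> sA sB; split.
  by exists 0; [case: sA | exists 0; [case: sB | rewrite addr0]].
move=> c _ _ [x Ax [y By <-]] [x' Ax' [y' By' <-]].
exists (c *: x + x'); first exact: sA.2.
exists (c *: y + y'); first exact: sB.2.
by rewrite scalerDr addrACA.
Qed.

End Subspaces.

(** * Coordinates modulo a subspace *)

Section Coordinates.
Variables (K : fieldType) (V : vectType K).

(** Take a subspace of largest dimension among those contained in [A]: it
    already contains every vector of [A], since adjoining one would increase
    the dimension. *)
Lemma subspace_vspace (A : set V) : is_subspace A ->
  exists U : {vspace V}, forall x, A x <-> x \in U.
Proof.
move=> sA.
pose P d := `[< exists U : {vspace V},
  (forall x, x \in U -> A x) /\ \dim U = d >].
have exP : exists d, P d.
  exists (\dim (0%VS : {vspace V})); apply/asboolP; exists 0%VS; split=> //.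
  by move=> x; rewrite memv0 => /eqP->; case: sA.
have ubP d : P d -> (d <= \dim (fullv : {vspace V}))%N.
  by move=> /asboolP[U [_ <-]]; rewrite dimvS ?subvf.
case: (ex_maxnP exP ubP) => d /asboolP[U [UA dimU]] maxd.
exists U => x; split=> [Ax|]; last exact: UA.
have /maxd : P (\dim (U + <[x]>)%VS).
  apply/asboolP; exists (U + <[x]>)%VS; split=> // y.
  case/memv_addP=> u /UA Au [_ /vlineP[c ->] ->]; rewrite addrC.
  exact: sA.2.
rewrite -dimU => le_dim.
have /eqP-> : U == (U + <[x]>)%VS by rewrite eqEdim addvSl.
by apply: (subvP (addvSr _ _)); rewrite memv_line.
Qed.

(** The forms [a j] are a basis of the annihilator of [A], with dual vectors
    [e j] in a complement of [A]: project along [A] onto the complement and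
    read off coordinates there. *)
Lemma coordinates_modulo (A : set V) : is_subspace A ->
  exists (n : nat) (a : 'I_n -> V -> K) (e : 'I_n -> V),
    [/\ forall j, scalar (a j),
        forall j x, A x -> a j x = 0
      & forall x, A (x - \sum_j a j x *: e j)].
Proof.
case/subspace_vspace=> U AU; pose b := vbasis U^C.
exists (\dim U^C), (fun j x => coord b j (x - projv U x)), (fun j => b`_j).
split=> [j c x y | j x /AU Ux | x] /=.
- by rewrite -linearP scalerBr linearP opprD addrACA.
- by rewrite projv_id // subrr linear0.
- by apply/AU; rewrite -coord_vbasis ?memv_projC // subKr memv_proj.
Qed.

End Coordinates.

(** * The series [a] and [h] *)

Section LieBracket.
Variables (K : fieldType) (g : lieAlgType K).
Implicit Types X Y : g.

Lemma lie0l X : lie 0 X = 0.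
Proof.
have := lie_linearl X (-1) 0 0.
by rewrite scaler0 addr0 scaleN1r addNr.
Qed.

Lemma lieNl X Y : lie (- X) Y = - lie X Y.
Proof. by have := lie_linearl Y (-1) X 0; rewrite !scaleN1r lie0l !addr0. Qed.

Lemma lie_anti X Y : lie X Y = - lie Y X.
Proof.
apply/eqP; rewrite -addr_eq0; apply/eqP.
have lD A B C : lie (A + B) C = lie A C + lie B C :> g.
  by have := lie_linearl C 1 A B; rewrite !scale1r.
have rD A B C : lie C (A + B) = lie C A + lie C B :> g.
  by have := lie_linearr C 1 A B; rewrite !scale1r.
by have := liexx (X + Y); rewrite lD !rD !liexx add0r addr0.
Qed.

End LieBracket.

Section Series.
Variables (K : fieldType) (g : lieAlgType K) (J : 'End(g)).
Hypothesis JJ : forall X, J (J X) = - X.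

Lemma image_subspace (A : set g) : is_subspace A -> is_subspace (J @` A).
Proof.
case=> A0 AL; split; first by exists 0; rewrite ?linear0.
move=> c _ _ [x Ax <-] [y Ay <-]; exists (c *: x + y); first exact: AL.
by rewrite linearP.
Qed.

Lemma h_series_subspace k : is_subspace (h_series J k).
Proof.
case: k => [|k] //=; apply: set_sum_subspace; last apply: image_subspace;
  exact: linear_span_subspace.
Qed.

Lemma h_series_J k X : h_series J k X -> h_series J k (J X).
Proof.
case: k => [|k] //= [u su [_ [v sv <-] <-]].
exists (- v); first by apply: subspaceN => //; exact: linear_span_subspace.
by exists (J u); [exists u | rewrite linearD /= JJ addrC].
Qed.

Lemma h_series_lie k X Y : h_series J k X -> h_series J k.+1 (lie X Y).
Proof.
move=> hX; exists (lie X Y).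
  by apply: linear_span_incl; exists X => //; exists Y.
exists 0; rewrite ?addr0 //.
by case: (image_subspace (linear_span_subspace
            [set lie x y | x in h_series J k & y in [set: g]])).
Qed.

Lemma a_series_subspace k : is_subspace (a_series J k).
Proof.
elim: k => [|k IHk] /=.
  by split=> // c _ _ -> ->; rewrite scaler0 addr0.
split=> [|c x y [ax aJx] [ay aJy]].
  by split=> Y; rewrite ?linear0 lie0l; case: IHk.
by split=> Y; rewrite ?linearP lie_linearl; apply: IHk.2.
Qed.

Lemma a_series_J k X : a_series J k X -> a_series J k (J X).
Proof.
case: k => [|k] /=; first by move->; rewrite linear0.
case=> aX aJX; split=> // Y; rewrite JJ lieNl.
by apply: subspaceN => //; apply: a_series_subspace.
Qed.

(** Minimality of [h_series J k.+1] among [J]-stable subspaces containing the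
    brackets of [h_series J k] with [g]. *)
Lemma h_series_succ_subset k (A : set g) : is_subspace A ->
  (forall X, A X -> A (J X)) ->
  (forall X Y, h_series J k X -> A (lie X Y)) -> h_series J k.+1 `<=` A.
Proof.
move=> sA AJ hA.
have sub : lie_span (h_series J k) setT `<=` A.
  by apply: linear_span_subset => // _ [X hX [Y _ <-]]; apply: hA.
move=> _ [u /sub Au [_ [v /sub Av <-] <-]].
by apply: subspaceD => //; apply: AJ.
Qed.

(** The two series are compared at complementary indices, starting from the
    end where the hypothesis makes the inclusion trivial. *)
Lemma a_series_full_iff k : a_series J k = setT <-> h_series J k = [set 0].
Proof.
have h0 i : h_series J i 0 by case: (h_series_subspace i).
split=> [ak|hk].
  suff sub i : (i <= k)%N -> h_series J i `<=` a_series J (k - i).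
    apply/seteqP; split=> [X /sub|_ ->] //.
    by rewrite subnn; apply.
  elim: i => [|i IHi] lik; first by rewrite subn0 ak.
  apply: h_series_succ_subset; first exact: a_series_subspace.
    exact: a_series_J.
  move=> X Y /(IHi (ltnW lik)).
  by rewrite -(subnSK lik); case=> aX _; exact: aX.
suff sub i : (i <= k)%N -> h_series J (k - i) `<=` a_series J i.
  apply/seteqP; split=> // X _; apply: (sub k) => //.
  by rewrite subnn.
elim: i => [|i IHi] lik; first by rewrite subn0 hk.
move=> X hX; split=> Y; apply: IHi; rewrite ?(ltnW lik) // -(subnSK lik);
  apply: h_series_lie => //.
exact: h_series_J.
Qed.

End Series.

(** * Forms of type (1,0) *)

Lemma skew_sum_swap (A : comPzRingType) (I : finType)
    (c : I -> I -> A) (u v : I -> A) :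
  (forall j l, c j l = - c l j) ->
  \sum_(p : I * I) c p.1 p.2 * (u p.1 * v p.2) =
  - \sum_(p : I * I) c p.1 p.2 * (v p.1 * u p.2).
Proof.
move=> cN.
rewrite (reindex_inj (h := fun p : I * I => (p.2, p.1))) /=; last first.
  by move=> [x1 x2] [y1 y2] [-> ->].
rewrite -sumrN; apply: eq_bigr => p _.
by rewrite cN (mulrC (u _)) mulNr.
Qed.

Section Forms.
Variables (R : realType) (g : lieAlgType R) (J : 'End(g)).
Hypothesis J_cplx : complex_structure J.

Lemma complex_dual0 (w : g -> R[i]) : complex_dual g w -> w 0 = 0.
Proof.
move=> lw; have := lw (-1) 0 0; rewrite scaler0 addr0 rmorphN rmorph1.
by rewrite mulN1r addNr.
Qed.

Lemma complex_dual_sum (w : g -> R[i]) (I : finType) (c : I -> R) (x : I -> g) :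
  complex_dual g w -> w (\sum_j c j *: x j) = \sum_j (c j)%:C%C * w (x j).
Proof.
move=> lw; elim/big_ind2: _ => [|_ x1 _ x2 <- <-|j _].
- exact: complex_dual0.
- by have := lw 1 x1 x2; rewrite scale1r rmorph1 mul1r.
- by have := lw (c j) (x j) 0; rewrite !addr0 complex_dual0 // addr0.
Qed.

(** Twice the (1,0)-part of the real form [a]. *)
Definition form10_of (a : g -> R) : g -> R[i] :=
  fun X => (a X)%:C%C - 'i%C * (a (J X))%:C%C.

Lemma form10_of_forms10 (a : g -> R) : scalar a -> forms10 J (form10_of a).
Proof.
move=> la; split=> [c X Y|X]; rewrite /form10_of.
  by rewrite linearP !la !rmorphD !rmorphM /=; ring.
have aN Y : a (- Y) = - a Y.
  have a0 : a 0 = 0.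
    by have := la (-1) 0 0; rewrite scaler0 addr0 mulN1r addNr.
  by have := la (-1) Y 0; rewrite !addr0 a0 addr0 scaleN1r mulN1r.
rewrite J_cplx.1 aN rmorphN /= mulrBr mulrA -expr2 sqr_i.
by rewrite mulN1r !mulrN !opprK addrC.
Qed.

Lemma conj_form10_of (a : g -> R) X :
  conj_form (form10_of a) X = (a X)%:C%C + 'i%C * (a (J X))%:C%C.
Proof.
rewrite /conj_form /form10_of; simpc.
by rewrite /= opprK.
Qed.

Lemma form10_of_add_conj (a : g -> R) X :
  form10_of a X + conj_form (form10_of a) X = 2 * (a X)%:C%C.
Proof. by rewrite conj_form10_of /form10_of; ring. Qed.

Lemma sum_formE (I : finType) (c : I -> R[i]) (u : I -> g -> g -> R[i]) X Y :
  (\sum_i c i *: u i) X Y = \sum_i c i * u i X Y.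
Proof.
elim/big_ind2: _ => // u1 s1 u2 s2 <- <-.
by rewrite !addrfctE.
Qed.

Definition forms10_ann (A : set g) : set (g -> R[i]) :=
  [set v | forms10 J v /\ forall X, A X -> v X = 0].

(** Let the real forms [a j] be a coframe modulo [A] and [eta j] twice the
    (1,0)-part of [a j], so that [a j = (eta j + conj (eta j)) / 2].  By
    hypothesis [w (lie X Y)] only depends on [X] and [Y] modulo [A], hence is
    the sum of the [c j l * a j X * a l Y].  Expanding each [a j] gives four
    sums over [(j, l)], one for each choice of types.  The sum with two
    conjugates vanishes by integrability, and skew-symmetry of [c] turns the
    others into combinations of wedge products. *)
Lemma dform_wedge_decomposition (A : set g) (w : g -> R[i]) :
  is_subspace A -> (forall X, A X -> A (J X)) -> forms10 J w ->
  (forall X Y, A X -> w (lie X Y) = 0) ->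
  set_sum (wedge_span (forms10_ann A) (forms10_ann A))
          (wedge_span (forms10_ann A) (@conj_form R g @` forms10_ann A)) (dform w).
Proof.
move=> sA AJ [lw wJ] wA.
have [n [a [e [la aA Ae]]]] := coordinates_modulo sA.
have wN X : w (- X) = - w X.
  have := lw (-1) X 0; rewrite !addr0 complex_dual0 // addr0 scaleN1r.
  by rewrite rmorphN rmorph1 mulN1r.
have wD X Y : w (X + Y) = w X + w Y.
  by have := lw 1 X Y; rewrite scale1r rmorph1 mul1r.
have wAr X Y : A X -> w (lie Y X) = 0 by move=> AX; rewrite lie_anti wN wA ?oppr0.
pose c j l := w (lie (e j) (e l)).
have cN j l : c j l = - c l j by rewrite /c lie_anti wN.
have lin1 Y : complex_dual g (fun X => w (lie X Y)).
  by move=> r X X'; rewrite lie_linearl lw.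
have lin2 X : complex_dual g (fun Y => w (lie X Y)).
  by move=> r Y Y'; rewrite lie_linearr lw.
have bE X Y : w (lie X Y) =
    \sum_(p : 'I_n * 'I_n) c p.1 p.2 * ((a p.1 X)%:C%C * (a p.2 Y)%:C%C).
  rewrite -{1}[X](subrK (\sum_j a j X *: e j)).
  have -> Z : w (lie (X - \sum_j a j X *: e j + Z) Y) = w (lie Z Y).
    have := lin1 Y 1 (X - \sum_j a j X *: e j) Z.
    by rewrite scale1r rmorph1 mul1r (wA _ _ (Ae X)) add0r.
  rewrite (complex_dual_sum _ _ (lin1 Y)).
  rewrite -(pair_big xpredT xpredT (fun j l => c j l * ((a j X)%:C%C * (a l Y)%:C%C))) /=.
  apply: eq_bigr => j _.
  rewrite -{1}[Y](subrK (\sum_l a l Y *: e l)).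
  have -> Z : w (lie (e j) (Y - \sum_l a l Y *: e l + Z)) = w (lie (e j) Z).
    have := lin2 (e j) 1 (Y - \sum_l a l Y *: e l) Z.
    by rewrite scale1r rmorph1 mul1r (wAr _ _ (Ae Y)) add0r.
  rewrite (complex_dual_sum _ _ (lin2 (e j))) mulr_sumr.
  by apply: eq_bigr => l _; rewrite -/(c j l); ring.
pose eta j := form10_of (a j).
have Feta j : forms10_ann A (eta j).
  split; first exact: form10_of_forms10.
  by move=> X AX; rewrite /eta /form10_of !aA ?mulr0 ?subr0 //; apply: AJ.
pose S (u v : 'I_n -> R[i]) := \sum_(p : 'I_n * 'I_n) c p.1 p.2 * (u p.1 * v p.2).
(* Expanding the conjugates gives w of the combination
   [X,Y] + J[JX,Y] + J[X,JY] - [JX,JY], which integrability makes zero. *)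
have S02 X Y : S (fun j => conj_form (eta j) X) (fun l => conj_form (eta l) Y) = 0.
  have := J_cplx.2 X Y => /(congr1 w); rewrite !wD !wJ.
  move=> /eqP; rewrite -subr_eq0 => /eqP int0.
  suff <- : - (w (lie (J X) (J Y)) - ('i%C * w (lie (J X) Y) +
     'i%C * w (lie X (J Y)) + w (lie X Y))) =
     S (fun j => conj_form (eta j) X) (fun l => conj_form (eta l) Y).
    by rewrite int0 oppr0.
  rewrite !bE opprB !mulr_sumr -!big_split -sumrB /=; apply: eq_bigr => p _.
  rewrite !conj_form10_of.
  have i2 : 'i%C * 'i%C = -1 :> R[i] by rewrite -expr2 sqr_i.
  set x := (a _ X)%:C%C; set y := (a _ Y)%:C%C.
  set x' := (a _ (J X))%:C%C; set y' := (a _ (J Y))%:C%C.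
  rewrite [_ * ((x + _) * _)](_ : _ = c p.1 p.2 * (x * y + 'i%C * (x' * y)
    + 'i%C * (x * y') + 'i%C * 'i%C * (x' * y'))); last by ring.
  by rewrite i2; ring.
(* dw is -1/4 of the three remaining sums.  The two mixed ones are exchanged by
   skew-symmetry and make up one sum of wedge products; antisymmetrizing the
   (2,0) sum costs a further factor 2. *)
exists (\sum_(p : 'I_n * 'I_n) (- (c p.1 p.2 / 8)) *: wedge (eta p.1) (eta p.2)).
  by apply: linear_span_finsum => p; exists (eta p.1) => //; exists (eta p.2).
exists (\sum_(p : 'I_n * 'I_n)
  (- (c p.1 p.2 / 4)) *: wedge (eta p.1) (conj_form (eta p.2))).
  apply: linear_span_finsum => p; exists (eta p.1) => //.
  by exists (conj_form (eta p.2)) => //; exists (eta p.2).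
apply/funext=> X; apply/funext=> Y.
pose h Z j := eta j Z; pose k Z j := conj_form (eta j) Z.
transitivity (- (S (h X) (h Y) - S (h Y) (h X)) / 8
              - (S (h X) (k Y) - S (h Y) (k X)) / 4).
  rewrite -[LHS]/((\sum_p _) X Y + (\sum_p _) X Y) !sum_formE.
  rewrite /S -!sumrB -!sumrN !mulr_suml -sumrN -!big_split /=.
  apply: eq_bigr => p _.
  by rewrite /wedge /h /k; field.
have S_skew u v : S u v = - S v u by exact: skew_sum_swap.
rewrite (S_skew (h Y)) (S_skew (h Y) (k X)) /dform bE.
have S02XY : S (k X) (k Y) = 0 by exact: S02.
transitivity (- (S (h X) (h Y) + S (h X) (k Y) + S (k X) (h Y) + S (k X) (k Y)) / 4).
  by rewrite S02XY; field.
rewrite /S -!big_split /= -sumrN mulr_suml -sumrN; apply: eq_bigr => p _.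
have aE j Z : (a j Z)%:C%C = (h Z j + k Z j) / 2.
  by rewrite /h /k /eta form10_of_add_conj; field.
by rewrite !aE; field.
Qed.

Lemma wedge_span_vanishing (F G : set (g -> R[i])) (X Y : g) b :
  (forall v, F v -> v X = 0) -> (forall v, G v -> v X = 0) ->
  wedge_span F G b -> b X Y = 0.
Proof.
move=> F0 G0 [n [c [u [uFG ->]]]]; rewrite sum_formE big1 // => i _.
have [v Fv [v' Gv' <-]] := uFG i.
by rewrite /wedge F0 // G0 // mul0r mulr0 subrr mulr0.
Qed.

(** Duality between the series [W] and [h].  As [w (J X) = 'i * w X], the kernel
    of [w] is [J]-stable, so [w] vanishes on [h^(k+1)] as soon as it vanishes
    on the brackets [[h^k, g]], that is, as soon as [dw] is killed by
    contraction with [h^k]. *)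
Lemma W_seriesE k : W_series J k = forms10_ann (h_series J k).
Proof.
elim: k => [|k IHk].
  apply/seteqP; split=> w /=; last by case=> _ w0; apply/funext => X; apply: w0.
  move=> ->; split=> //; split=> [c X Y|X] /=.
    by rewrite mulr0 addr0.
  by rewrite mulr0.
apply/seteqP; split=> w /=; rewrite IHk.
  case=> w10 [b1 B1 [b2 B2 dw]]; split=> // X hX.
  have [lw wJ] := w10.
  pose N : set g := [set Z | w Z = 0].
  have sN : is_subspace N.
    split; first exact: complex_dual0.
    by move=> c x y x0 y0; rewrite /N /= lw x0 y0 mulr0 addr0.
  apply: (h_series_succ_subset sN _ _ hX) => [Z Z0|Z Y hZ]; rewrite /N /=.
    by rewrite wJ Z0 mulr0.
  apply: oppr_inj; rewrite oppr0 -[LHS]/(dform w Z Y) -dw.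
  rewrite -[LHS]/(b1 Z Y + b2 Z Y).
  have F0 v : forms10_ann (h_series J k) v -> v Z = 0 by case=> _; apply.
  rewrite (wedge_span_vanishing _ F0 F0 B1) (wedge_span_vanishing _ F0 _ B2) ?addr0 //.
  by move=> _ [v Fv <-]; rewrite /conj_form F0 // conjc0.
case=> w10 w0; split=> //; apply: dform_wedge_decomposition => //.
- exact: h_series_subspace.
- by move=> X; apply: h_series_J; exact: J_cplx.1.
- by move=> X Y hX; apply: w0; apply: h_series_lie.
Qed.

(** Real forms separate points, and a real form is the real part of a
    (1,0)-form. *)
Lemma forms10_separate (X : g) : (forall w, forms10 J w -> w X = 0) -> X = 0.
Proof.
move=> X0.
have s0 : is_subspace [set (0 : g)].
  by split=> // c _ _ -> ->; rewrite scaler0 addr0.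
have [n [a [e [la _ ae]]]] := coordinates_modulo s0.
have /= /eqP := ae X; rewrite subr_eq0 => /eqP ->.
rewrite big1 // => j _; suff -> : a j X = 0 by rewrite scale0r.
have := X0 _ (form10_of_forms10 (la j)); rewrite /form10_of.
by move=> /(congr1 (@complex.Re R)); simpc => /=; rewrite ?oppr0 ?addr0.
Qed.

Lemma W_series_full_iff k : W_series J k = forms10 J <-> h_series J k = [set 0].
Proof.
rewrite W_seriesE; split=> [Wk|hk].
  apply/seteqP; split=> [X hX|_ ->]; last by case: (h_series_subspace J k).
  by apply: forms10_separate => w; rewrite -Wk; case=> _; apply.
apply/seteqP; split=> w [w10 wh] //; split=> // X.
by rewrite hk => ->; apply: complex_dual0.
Qed.

End Forms.

Theorem theorem1p2 (R : realType) (g : lieAlgType R)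
    (g_pos : (0 < \dim (fullv : {vspace g}))%N)
    (g_nil : nilpotent_lie g)
    (J : 'End(g)) (J_cplx : complex_structure J) (t : nat) :
  (a_series J t = setT /\ a_series J t.-1 `<` setT
   <->
   W_series J t = forms10 J /\ W_series J t.-1 `<` forms10 J)
  /\
  (W_series J t = forms10 J /\ W_series J t.-1 `<` forms10 J
   <->
   h_series J t = [set 0] /\ h_series J t.-1 <> [set 0]).
Proof.
have aP k : a_series J k = setT <-> h_series J k = [set 0].
  exact: a_series_full_iff J_cplx.1 k.
have WP k := W_series_full_iff J_cplx k.
have aS k : a_series J k `<` setT <-> h_series J k <> [set 0].
  rewrite properEneq -aP; split=> [[/eqP]//|ak]; split=> //.
  exact/eqP.
have WS k : W_series J k `<` forms10 J <-> h_series J k <> [set 0].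
  rewrite properEneq -WP; split=> [[/eqP]//|Wk]; split; first exact/eqP.
  by rewrite W_seriesE // => w [].
by rewrite !aP !WP !aS !WS.
Qed.
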